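(* Let $d\ge 2$, $\mathbb I_d=\{1,\dots,d\}$, and fix $i\in\mathbb I_d$ and $T>0$. Let $\boldsymbol L=(\boldsymbol L(t))_{t\ge0}$ be an $\mathbb R_+^d$-valued Lévy process satisfying the Insurance Claim Assumption (stated in the context); in particular, with the positive measurable function $f_i:(0,\infty)\to(0,\infty)$ satisfying $f_i(1)=1$, the index $\alpha_i>0$, the scaling function $b_i\in\mathcal{RV}_{1/\alpha_i}$ and the non-zero limit measure $\mu_i$ of that assumption, $$\boldsymbol L(T)\in\mathcal{MRV}\big(\alpha_i,b_i,f_i(T)\mu_i,\mathbb E_d^{(i)}\big).$$ Let $\boldsymbol Q=(\boldsymbol Q(t))_{t\ge 0}$ be an $\mathbb R^d$-valued process independent of $\boldsymbol L$ such that $\overline{Q}_T:=\sup_{0\le t\le T}\|\boldsymbol Q(t)\|_\infty$ satisfies $\mathbb E|\overline{Q}_T|^{\alpha_i+\gamma}<\infty$ for some $\gamma>0$. Let $\boldsymbol a\in(0,\infty)^d$ with $\sum_{j=1}^d a_j=1$, let $\boldsymbol p\in\mathbb R_+^d$, and for $u>0$ put $$\boldsymbol R_u^{\boldsymbol Q}(t)=u\boldsymbol a+t\boldsymbol p-\boldsymbol L(t)+\boldsymbol Q(t),\qquad t\ge 0.$$ Let $\Lambda=-(\boldsymbol x+C)$, where $\boldsymbol x\in\mathbb R_+^d$ and $C\subset\mathbb R^d$ is a Borel increasing cone, and let $$\psi_u^{\boldsymbol Q}(\Lambda,T)=\mathbb P\big(\boldsymbol R_u^{\boldsymbol Q}(t)\in\Lambda\text{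 for some }t\in[0,T]\big).$$ Let $B_\Lambda:=(\boldsymbol a+C)\cap\mathbb R_+^d\in\mathcal B(\mathbb E_d^{(i)})$, and assume that $B_\Lambda$ is bounded away from $\mathbb{CA}_d^{(i-1)}$ and is a $\mu_i$-continuity set. Then $$\lim_{u\to\infty}b_i^{\leftarrow}(u)\,\psi_u^{\boldsymbol Q}(\Lambda,T)=f_i(T)\,\mu_i(B_\Lambda),$$ which is independent of $\boldsymbol x$. Moreover, if $0<\mu_i(B_\Lambda)<\infty$, then $$\psi_u^{\boldsymbol Q}(\Lambda,T)\sim\mathbb P\big(\boldsymbol L(T)\in uB_\Lambda\big),\qquad u\to\infty.$$
   Context: Notation. $\mathbb R_+=[0,\infty)$. For $\boldsymbol z\in\mathbb R^d$, $z_{(1)}\ge\cdots\ge z_{(d)}$ are the decreasing order statistics of its coordinates, and $\|\cdot\|_\infty$ is the sup norm. $f(u)\sim g(u)$ means $f(u)/g(u)\to1$ as $u\to\infty$. For a nondecreasing $g:\mathbb R_+\to\mathbb R_+$, the generalized inverse is $g^{\leftarrow}(u)=\inf\{t>0:g(t)\ge u\}$. A Lévy process has $\boldsymbol L(0)=\boldsymbol 0$ almost surely, stationary and independent increments, and càdlàg paths. An $\mathbb R_+^d$-valued Lévy process is a subordinator: its paths are coordinatewise nondecreasing. Subcones. For $i\in\mathbb I_d$, $$\mathbb{CA}_d^{(i-1)}=\{\boldsymbol z\in\mathbb R_+^d:z_{(i)}=0\},\qquad \mathbb E_d^{(i)}=\{\boldsymbol z\in\mathbb R_+^d:z_{(i)}>0\}=\mathbb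 R_+^d\setminus\mathbb{CA}_d^{(i-1)}.$$ $\mathcal B(\mathbb E_d^{(i)})$ is the Borel $\sigma$-algebra of $\mathbb E_d^{(i)}$. $\mathbb M(\mathbb E_d^{(i)})$ is the space of Borel measures on $\mathbb E_d^{(i)}$ that are finite on sets bounded away from $\mathbb{CA}_d^{(i-1)}$ (i.e. sets at positive distance from $\mathbb{CA}_d^{(i-1)}$). A set $B$ is a $\mu$-continuity set if $\mu(\partial B)=0$. Regular variation. A measurable $f:\mathbb R_+\to\mathbb R_+$ is in $\mathcal{RV}_\beta$, $\beta\in\mathbb R$, if $f(ux)/f(u)\to x^\beta$ as $u\to\infty$ for all $x>0$. A random vector $\boldsymbol Z\in\mathbb R_+^d$ is in $\mathcal{MRV}(\alpha_i,b_i,\mu_i,\mathbb E_d^{(i)})$ if $\alpha_i>0$, $b_i\in\mathcal{RV}_{1/\alpha_i}$, $\mu_i\in\mathbb M(\mathbb E_d^{(i)})$ is non-zero, and $$\lim_{u\to\infty}u\,\mathbb P\big(\boldsymbol Z\in b_i(u)B\big)=\mu_i(B)$$ for every $\mu_i$-continuity set $B\in\mathcal B(\mathbb E_d^{(i)})$ bounded away from $\mathbb{CA}_d^{(i-1)}$. Insurance Claim Assumption. $\boldsymbol L$ is an $\mathbb R_+^d$-valued Lévy process, and for each $k\in\mathbb I_d$ there exist a constant $\alpha_k>0$, a scaling function $b_k\in\mathcal{RV}_{1/\alpha_k}$, a non-zero measure $\mu_k$ on $\mathbb E_d^{(k)}$, and a positive measurable function $f_k:(0,\infty)\to(0,\infty)$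 with $f_k(1)=1$ such that $\boldsymbol L(T)\in\mathcal{MRV}(\alpha_k,b_k,f_k(T)\mu_k,\mathbb E_d^{(k)})$ for every $T>0$. Increasing cone. A set $C\subset\mathbb R^d$ is increasing if $\boldsymbol c\in C$ and $\boldsymbol z\in\mathbb R_+^d$ imply $\boldsymbol z+\boldsymbol c\in C$; it is a cone if $\lambda C=C$ for every $\lambda>0$. *)

(* Defs.v *)
From mathcomp Require Import all_boot all_order all_algebra.
From mathcomp Require Import all_classical all_reals all_analysis.
From mathcomp Require Import measurable_realfun.
Set Implicit Arguments.
Unset Strict Implicit.
Unset Printing Implicit Defensive.
Import Order.TTheory GRing.Theory Num.Theory.
Import numFieldNormedType.Exports.
Local Open Scope classical_set_scope.
Local Open Scope ring_scope.

(* R^d is 'rV[R]_d: `|z| is then the sup norm and the topology is the product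
   topology; borel_rV R d is the same type with its Borel sigma-algebra. *)
Notation borel_rV R d := (g_sigma_algebraType (@open 'rV[R]_d)).

Section Cones.
Context {R : realType} {d : nat}.
Implicit Types (z : 'rV[R]_d) (A B C E : set 'rV[R]_d).

Definition orthant : set 'rV[R]_d := [set z | forall j, 0 <= z ord0 j].

(* z_(k) for 1 <= k <= d, the indexing from 1 of the order statistics. *)
Definition order_stat z (k : nat) : R :=
  nth 0 (sort (fun s t => t <= s) [seq z ord0 j | j <- enum 'I_d]) k.-1.

(* coord_cone k is CA_d^(k-1) and subcone k is E_d^(k). *)
Definition coord_cone (k : nat) : set 'rV[R]_d :=
  [set z | orthant z /\ order_stat z k = 0].
Definition subcone (k : nat) : set 'rV[R]_d :=
  [set z | orthant z /\ 0 < order_stat z k].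

Definition dilate (s : R) B : set 'rV[R]_d := [set s *: z | z in B].
Definition translate z B : set 'rV[R]_d := [set z + c | c in B].

Definition bounded_away B A : Prop :=
  exists2 e : R, 0 < e & forall z c, B z -> A c -> e <= `|z - c|.

Definition borel_in E B : Prop :=
  measurable (B : set (borel_rV R d)) /\ B `<=` E.

(* The boundary of B in the topological space E (B a subset of E).  It differs
   from the boundary in R^d, which also contains the points of B lying on the
   faces of the orthant. *)
Definition boundary_in E B : set 'rV[R]_d :=
  E `&` (closure B `&` closure (E `\` B)).

Definition continuity_set (mu : {measure set (borel_rV R d) -> \bar R}) E B :=
  mu (boundary_in E B) = 0%E.

(* Measures in M(E_d^(k)), represented as Borel measures on R^d that are
   carried by E_d^(k). *)
Definition subcone_measure (k : nat)
    (mu : {measure set (borel_rV R d) -> \bar R}) : Prop :=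
  mu (~` subcone k) = 0%E /\
  forall B, borel_in (subcone k) B -> bounded_away B (coord_cone k) ->
    (mu B < +oo)%E.

Definition increasing_set C : Prop :=
  forall c z, C c -> orthant z -> C (z + c).
Definition is_cone C : Prop := forall s : R, 0 < s -> dilate s C = C.

End Cones.

Section RegularVariation.
Context {R : realType}.

(* Functions on [0, oo) are represented by functions on R whose values at
   negative arguments are irrelevant. *)
Definition regularly_varying (beta : R) (g : R -> R) : Prop :=
  [/\ measurable_fun `[(0 : R), +oo[ g,
      forall t, 0 <= t -> 0 <= g t &
      forall x, 0 < x -> g (u * x) / g u @[u --> +oo] --> x `^ beta].

(* Extended-real infimum, so that the infimum of the empty set is +oo. *)
Definition gen_inverse (g : R -> R) (u : R) : \bar R :=
  ereal_inf [set t%:E | t in [set t | 0 < t /\ u <= g t]].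

Definition MRV {dO : measure_display} {Omega : measurableType dO}
    (P : probability Omega R) {d : nat} (Z : Omega -> 'rV[R]_d)
    (alpha : R) (b : R -> R) (mu : {measure set (borel_rV R d) -> \bar R})
    (k : nat) : Prop :=
  [/\ 0 < alpha,
      regularly_varying alpha^-1 b,
      subcone_measure k mu,
      mu (subcone k) <> 0%E &
      forall B, borel_in (subcone k) B -> bounded_away B (coord_cone k) ->
        continuity_set mu (subcone k) B ->
        (u%:E * P (Z @^-1` dilate (b u) B))%E @[u --> +oo] --> mu B].

End RegularVariation.

(* Processes indexed by [0, oo) are functions on R whose values at negative
   times are irrelevant. *)
Section Processes.
Context {R : realType} {dO : measure_display} {Omega : measurableType dO}.
Context (P : probability Omega R) {d : nat}.
Implicit Types X Y : R -> Omega -> 'rV[R]_d.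

Definition process X : Prop :=
  forall t, 0 <= t -> measurable_fun setT (X t : Omega -> borel_rV R d).

Definition process_sigma_algebra X : set (set Omega) :=
  <<s [set A | exists t, exists B : set (borel_rV R d),
         [/\ 0 <= t, measurable B & A = X t @^-1` B]] >>.

Definition independent_processes X Y : Prop :=
  forall A B, process_sigma_algebra X A -> process_sigma_algebra Y B ->
    P (A `&` B) = (P A * P B)%E.

Definition stationary_increments X : Prop :=
  forall (s h : R) (B : set (borel_rV R d)),
    0 <= s -> 0 <= h -> measurable B ->
    P [set w | B (X (s + h) w - X s w)] = P [set w | B (X h w)].

Definition independent_increments X : Prop :=
  forall (n : nat) (t : nat -> R) (B : nat -> set (borel_rV R d)),
    0 <= t 0%N -> (forall j, t j <= t j.+1) -> (forall j, measurable (B j)) ->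
    let event j := [set w | B j (X (t j.+1) w - X (t j) w)] in
    P (\bigcap_(j in `I_n) event j) = (\prod_(j < n) P (event j))%E.

Definition cadlag_paths X : Prop :=
  forall w,
    (forall t, 0 <= t -> X s w @[s --> t^'+] --> X t w) /\
    (forall t, 0 < t -> cvg (X s w @[s --> t^'-])).

Definition levy_process X : Prop :=
  [/\ process X,
      {ae P, forall w, X 0 w = 0},
      stationary_increments X,
      independent_increments X &
      cadlag_paths X].

(* The families are indexed by 1 <= k <= d; f k is a positive function on
   (0, oo), extended to R by arbitrary positive values. *)
Definition insurance_claim (L : R -> Omega -> 'rV[R]_d)
    (alpha : nat -> R) (b : nat -> R -> R)
    (mu : nat -> {measure set (borel_rV R d) -> \bar R})
    (f : nat -> R -> {posnum R}) : Prop :=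
  [/\ levy_process L,
      forall t w, 0 <= t -> orthant (L t w) &
      forall k, (1 <= k <= d)%N ->
        [/\ 0 < alpha k,
            regularly_varying (alpha k)^-1 (b k),
            mu k (subcone k) <> 0%E,
            measurable_fun `](0 : R), +oo[ (fun t => (f k t)%:num) /\
              (f k 1)%:num = 1 &
            forall T, 0 < T ->
              MRV P (L T) (alpha k) (b k)
                (mscale (f k T)%:num%:nng (mu k)) k]].

Definition running_sup (Q : R -> Omega -> 'rV[R]_d) (T : R) (w : Omega)
    : \bar R :=
  ereal_sup [set (`|Q t w|)%:E | t in `[0, T]].

Definition risk_process (a p : 'rV[R]_d) (L Q : R -> Omega -> 'rV[R]_d)
    (u t : R) (w : Omega) : 'rV[R]_d :=
  u *: a + t *: p - L t w + Q t w.

Definition hitting_event X (Lambda : set 'rV[R]_d) (T : R) : set Omega :=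
  [set w | exists2 t, 0 <= t <= T & Lambda (X t w)].

End Processes.

(* Main.v *)
Require Import Defs.
From mathcomp Require Import all_boot all_order all_algebra.
From mathcomp Require Import all_classical all_reals all_analysis.
From mathcomp Require Import measurable_realfun ring lra.
Import Order.TTheory GRing.Theory Num.Theory.
Import numFieldNormedType.Exports.
Local Open Scope classical_set_scope.
Local Open Scope ring_scope.

(** The event of ruin by time T is squeezed between two events that only
    concern the end point L(T).  Write B for the region (a + C) meeting the
    orthant and S for the running supremum of the norm of Q.

    Since C is an increasing cone and L is coordinatewise nondecreasing, a path
    that enters the ruin set at some time t <= T satisfies
    L(T) + S 1 \in u (a + C).  All coordinates of a are positive, so as long as
    S < e u for a small e depending on s > 1, the perturbation S 1 is at most
    (1 - 1/s) u a, and it is absorbed by shrinking the dilation factor: L(T)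
    lies in (u/s) B.  In the other direction, if L(T) lies in (s u) B and
    S < e u, then the claims at time T still exceed u a + T p + x - Q(T), because
    (s - 1) u a dominates both e u and the constants T p and x for large u.  Thus
    (lemmas [ruin_sub_end] and [end_sub_ruin])

      P(L(T) \in s u B) - P(S >= e u) <= psi(u) <= P(L(T) \in (u/s) B) + P(S >= e u).

    The perturbation only ever dilates B itself, so no continuity set other than
    B is involved; the deviations of S enter through a union bound.

    What remains is one-variable analysis ([cvg_inverse_mul_perturbed]).  Let G
    be the generalized inverse of b and F(u) = P(L(T) \in u B), a nonincreasing
    function.  Regular variation of L(T) says v F(b(v)) -> m, the claimed limit;
    bracketing u between the values of b at points just below and just above
    G(u) turns this into G(u) F(u) -> m.  As G(s u) <= x G(u) eventually whenever
    x > s^alpha, the factors s and 1/s cost only a factor tending to 1 with s.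
    Finally G grows more slowly than every power u^r with r > alpha, while
    P(S >= e u) = O(u^-(alpha + gamma)) by the Markov inequality, so the error
    term is negligible. *)

(** * Multiplicative squeeze and powers *)

(** All comparisons below hold up to a factor x that is arbitrarily close to 1,
    with a comparison function that is itself allowed to depend on x. *)
Lemma cvg_of_factor_bounds {R : realType} (h : R -> R) (m : R) :
  0 <= m ->
  (forall x : R, 1 < x -> exists2 hU : R -> R, hU u @[u --> +oo] --> m &
     \forall u \near +oo, h u <= x * hU u) ->
  (forall x : R, 1 < x -> exists2 hL : R -> R, hL u @[u --> +oo] --> m &
     \forall u \near +oo, hL u <= x * h u) ->
  h u @[u --> +oo] --> m.
Proof.
move=> m0 hU hL; apply/cvgrPdist_le => e e0.
have m1 : 0 < m + 1 by rewrite ltr_wpDl.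
have me1 : 0 < m + 1 + e by rewrite addr_gt0.
pose x := 1 + e / (2 * (m + 1 + e)).
have x1 : 1 < x by rewrite /x ltrDl divr_gt0// mulr_gt0.
have xE : (x - 1) * (2 * (m + 1 + e)) = e.
  by rewrite /x [1 + _]addrC addrK divfK// gt_eqF// mulr_gt0.
have x2 : x <= 2 by nra.
(* The choice of x gives x (m + e / 4) <= m + e. *)
have [hu hum hu1] := hU _ x1.
have [hl hlm hl1] := hL _ x1.
have e4 : 0 < e / 4 by rewrite divr_gt0.
near=> u.
have hux : h u <= x * hu u by near: u.
have hlx : hl u <= x * h u by near: u.
have A : hu u <= m + e / 4.
  by near: u; apply: (cvgr_le _ hum); rewrite ltrDl.
have B : m - e / 4 <= hl u.
  by near: u; apply: (cvgr_ge _ hlm); rewrite ltrBlDr ltrDl.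
rewrite ler_distlC; apply/andP; split; nra.
Unshelve. all: by end_near. Qed.

Lemma powR_gt1 {R : realType} (x r : R) : 1 < x -> 0 < r -> 1 < x `^ r.
Proof.
move=> x1 r0; have : 1 `^ r < x `^ r.
  by apply: gt0_ltr_powR => //; rewrite nnegrE// ltW// (lt_trans ltr01).
by rewrite powR1.
Qed.

Lemma ltr_powR {R : realType} (x r s : R) : 1 < x -> r < s -> x `^ r < x `^ s.
Proof.
move=> x1 rs; have x0 : 0 < x := lt_trans ltr01 x1.
rewrite -(subrK r s) powRD; last by rewrite (gt_eqF x0) implybT.
by rewrite ltr_pMl ?powR_gt0// powR_gt1// subr_gt0.
Qed.

(** * Generalized inverse of a regularly varying function *)

Section GeneralizedInverse.
Context {R : realType} (b : R -> R) (beta : R).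
Hypothesis b_nd : forall s t : R, 0 <= s -> s <= t -> b s <= b t.
Hypothesis b_rv : regularly_varying beta b.
Hypothesis beta_gt0 : 0 < beta.

Let G (u : R) : R := fine (gen_inverse b u).

Let ratio {x y : R} : 0 < x -> y < x `^ beta ->
  \forall u \near +oo, y < b (u * x) / b u.
Proof. by move=> x0 yx; case: b_rv => _ _ /(_ x x0) /cvgr_gt; apply. Qed.

(** The quotient by zero is zero, so b cannot vanish where b(u * 1) / b u is
    close to 1. *)
Lemma rv_gt0 : \forall u \near +oo, 0 < b u.
Proof.
have h2 : 2^-1 < (1 : R) `^ beta by rewrite powR1 invf_lt1// ltr1n.
have H := ratio ltr01 h2.
near=> u.
have h : 2^-1 < b (u * 1) / b u by near: u.
rewrite lt_neqAle; apply/andP; split.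
  apply/eqP => bu; move: h; rewrite -bu invr0 mulr0 => h.
  by have : 0 < 2^-1 :> R by []; rewrite ltNge (ltW h).
case: b_rv => _ b0 _; apply: b0; near: u.
by apply: nbhs_pinfty_ge; rewrite num_real.
Unshelve. all: by end_near. Qed.

(** If b were bounded, doubling the argument at a point where b nearly reaches
    its supremum would exceed that supremum, as it multiplies b by almost
    2^beta > 1. *)
Lemma rv_unbounded (K : R) : exists2 t, 0 < t & K <= b t.
Proof.
apply: contrapT => nK.
have bK t : 0 < t -> b t <= K.
  by move=> t0; rewrite leNgt; apply/negP => /ltW Kb; apply: nK; exists t.
have q1 : 1 < (2 : R) `^ beta.
  by apply: powR_gt1 => //; rewrite ltr1n.
pose q := (1 + 2 `^ beta) / 2.
have [q1' q2] : 1 < q /\ q < 2 `^ beta by rewrite /q; split; lra.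
have : \forall u \near +oo, [/\ 0 < b u, 0 < u & q * b u < b (u * 2)].
  have Hr := ratio (ltr0Sn _ 1) q2.
  have Hb := rv_gt0; have H0 := nbhs_pinfty_gt (num_real (0 : R)).
  near=> u; have bu : 0 < b u by near: u.
  split => //.
  by rewrite -ltr_pdivlMr//; near: u.
case=> M [_ HM]; pose E := [set b t | t in [set t | M < t /\ 0 < t]].
have supE : has_sup E.
  split; last by exists K => _ [t [_ t0] <-]; exact: bK.
  exists (b (`|M| + 1)), (`|M| + 1) => //; split; last by rewrite ltr_wpDl.
  by rewrite (le_lt_trans (ler_norm _))// ltrDl.
have S0 : 0 < sup E.
  have Mt : M < `|M| + 1 by rewrite (le_lt_trans (ler_norm _))// ltrDl.
  have [b0 t0 _] := HM _ Mt.
  apply: (lt_le_trans b0); apply: ub_le_sup; first by case: supE.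
  by exists (`|M| + 1).
have e0 : 0 < sup E - sup E / q.
  by rewrite subr_gt0 ltr_pdivrMr ?(lt_trans _ q1')// ltr_pMr.
have [_ [t [Mt t0] <-]] := sup_adherent e0 supE.
rewrite subKr ltr_pdivrMr ?(lt_trans _ q1')// mulrC => h.
have [_ _ h2] := HM _ Mt.
have : b (t * 2) <= sup E.
  apply: ub_le_sup; first by case: supE.
  exists (t * 2) => //; split; last by rewrite mulr_gt0.
  by rewrite (lt_trans Mt)// ltr_pMr// ltr1n.
by rewrite leNgt (lt_trans h).
Unshelve. all: by end_near. Qed.

Lemma gen_inverse_ge0 (u : R) : (0 <= gen_inverse b u)%E.
Proof. by apply: le_ereal_inf_tmp => _ [t [t0 _] <-]; rewrite lee_fin ltW. Qed.

Lemma gen_inverse_fin (u : R) : gen_inverse b u \is a fin_num.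
Proof.
rewrite ge0_fin_numE ?gen_inverse_ge0//.
have [t t0 ut] := rv_unbounded u.
by apply: (@le_lt_trans _ _ t%:E); [apply: ereal_inf_lbound; exists t|exact: ltry].
Qed.

Let GE (u : R) : gen_inverse b u = (G u)%:E.
Proof. by rewrite fineK// gen_inverse_fin. Qed.

Lemma inverse_le {u t : R} : 0 < t -> u <= b t -> G u <= t.
Proof.
by move=> t0 ut; rewrite -lee_fin -GE; apply: ereal_inf_lbound; exists t.
Qed.

Lemma lt_of_lt_inverse {u t : R} : 0 < t -> t < G u -> b t < u.
Proof. by move=> t0 tG; rewrite ltNge; apply/negP => /(inverse_le t0); rewrite leNgt tG. Qed.

Lemma le_of_inverse_lt {u t : R} : G u < t -> u <= b t.
Proof.
rewrite -lte_fin -GE => /ereal_inf_lt [_ [s [s0 us] <-]]; rewrite lte_fin => st.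
by rewrite (le_trans us)// b_nd// ltW.
Qed.

Lemma inverse_nd {u v : R} : u <= v -> G u <= G v.
Proof.
move=> uv; rewrite -lee_fin -!GE; apply: ereal_inf_le_tmp => _ [t [t0 vt] <-].
by exists t => //; split=> //; exact: le_trans vt.
Qed.

Lemma inverse_cvgy : G u @[u --> +oo] --> +oo.
Proof.
apply/cvgryPge => A.
near=> u.
have /le_trans : A <= `|A| + 1 by rewrite (le_trans (ler_norm _))// lerDl.
apply; rewrite leNgt; apply/negP => /le_of_inverse_lt; rewrite leNgt => /negP; apply.
by near: u; apply: nbhs_pinfty_gt; rewrite num_real.
Unshelve. all: by end_near. Qed.

Lemma inverse_near_gt0 : \forall u \near +oo, 0 < G u.
Proof.
have /cvgryPgt := inverse_cvgy; exact.
Qed.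

(** For v = y G(u) with y < 1 one has b(v) < u, and for y > 1 one has u <= b(v);
    monotonicity of F compares F(u) with F(b(v)) in each case. *)
Lemma cvg_inverse_mul {F : R -> R} {m : R} : 0 <= m ->
  (forall s t, 0 < s -> s <= t -> F t <= F s) ->
  v * F (b v) @[v --> +oo] --> m -> G u * F u @[u --> +oo] --> m.
Proof.
move=> m0 F_ni Hm; have Gy := inverse_cvgy; have G0 := inverse_near_gt0.
have scaled (y : R) : 0 < y -> (y * G u) * F (b (y * G u)) @[u --> +oo] --> m.
  move=> y0; apply: (cvg_comp _ _ _ Hm); exact: gt0_cvgMry.
have bpos (y : R) : 0 < y -> \forall u \near +oo, 0 < b (y * G u).
  move=> y0; have := rv_gt0; apply: (_ : y * G u @[u --> +oo] --> +oo).
  exact: gt0_cvgMry.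
apply: cvg_of_factor_bounds => // x x1; have x0 : 0 < x := lt_trans ltr01 x1.
- exists (fun u => (x^-1 * G u) * F (b (x^-1 * G u))).
    by apply: scaled; rewrite invr_gt0.
  have := bpos x^-1; rewrite invr_gt0 => /(_ x0) Hb.
  near=> u; have Gu : 0 < G u by near: u.
  rewrite !mulrA divff ?gt_eqF// mul1r ler_pM2l//; apply: F_ni; first by near: u.
  apply/ltW/lt_of_lt_inverse; first by rewrite mulr_gt0// invr_gt0.
  by rewrite gtr_pMl// invf_lt1.
- exists (fun u => (x * G u) * F (b (x * G u))); first exact: scaled.
  near=> u; have Gu : 0 < G u by near: u.
  rewrite -mulrA ler_pM2l// ler_pM2l//; apply: F_ni.
    by near: u; apply: nbhs_pinfty_gt; rewrite num_real.
  by apply: le_of_inverse_lt; rewrite ltr_pMl.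
Unshelve. all: by end_near. Qed.

(** The half of the regular variation of the inverse, with index 1 / beta, that
    the proof uses; applying it at u / s instead of u gives the other half. *)
Lemma inverse_scale_le {s x : R} : 1 <= s -> s `^ beta^-1 < x ->
  \forall u \near +oo, G (s * u) <= x * G u.
Proof.
move=> s1 sx; have s0 : 0 < s := lt_le_trans ltr01 s1.
pose y := (s `^ beta^-1 + x) / 2.
have p0 : 0 < s `^ beta^-1 by rewrite powR_gt0.
have [sy yx] : s `^ beta^-1 < y /\ y < x by rewrite /y; split; lra.
have y0 : 0 < y := lt_trans p0 sy.
have syb : s < y `^ beta.
  have : (s `^ beta^-1) `^ beta < y `^ beta.
    by apply: gt0_ltr_powR => //; rewrite nnegrE ltW.
  by rewrite -powRrM mulVf ?gt_eqF// powRr1// ltW.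
(* b at the point x / y * G u is already above u; multiplying that point by y
   multiplies b by more than s. *)
have xy0 : 0 < x / y by rewrite divr_gt0// (lt_trans p0).
have Gy := inverse_cvgy; have G0 := inverse_near_gt0.
have cy : x / y * G u @[u --> +oo] --> +oo by exact: gt0_cvgMry.
have Hr := cy _ (ratio y0 syb).
have Hb := cy _ rv_gt0.
near=> u; have Gu : 0 < G u by near: u.
apply: inverse_le; first by rewrite mulr_gt0// (lt_trans p0).
have -> : x * G u = x / y * G u * y by field; rewrite gt_eqF.
have bv : 0 < b (x / y * G u) by near: u.
apply: (@le_trans _ _ (s * b (x / y * G u))).
  rewrite ler_pM2l//; apply: le_of_inverse_lt.
  by rewrite ltr_pMl// ltr_pdivlMr// mul1r.
by rewrite -ler_pdivlMr// ltW//; near: u.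
Unshelve. all: by end_near. Qed.

(** Doubling the argument multiplies G by at most 2^r from some point u0 on, and
    G is monotone in between; hence G grows at most like u^r. *)
Lemma inverse_growth {r : R} : beta^-1 < r ->
  exists K : R, \forall u \near +oo, G u <= K * u `^ r.
Proof.
move=> rb; have r0 : 0 < r by rewrite (lt_trans _ rb)// invr_gt0.
have s2 : (2 : R) `^ beta^-1 < 2 `^ r by apply: ltr_powR => //; rewrite ltr1n.
have [M [_ HM]] := inverse_scale_le (ler1n _ 2) s2.
pose u0 := `|M| + 1; have u00 : 0 < u0 by rewrite /u0 ltr_wpDl.
have Mu0 : M < u0 by rewrite /u0 (le_lt_trans (ler_norm _))// ltrDl.
have u0r : 0 < u0 `^ r by rewrite powR_gt0.
have Gu0 u : 0 <= G u by rewrite fine_ge0// gen_inverse_ge0.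
have K0 : 0 <= 2 `^ r * G u0 by rewrite mulr_ge0// powR_ge0.
have base u : u0 <= u -> u <= 2 * u0 -> G u * u0 `^ r <= 2 `^ r * G u0 * u `^ r.
  move=> h1 h2; apply: ler_pM => //; first exact: powR_ge0.
  - exact: le_trans (inverse_nd h2) (HM _ Mu0).
  - have uge0 : 0 <= u by rewrite ltW// (lt_le_trans u00).
    by apply: ge0_ler_powR; rewrite ?nnegrE// ltW.
have main n u : u0 <= u -> u <= 2 ^+ n * u0 -> G u * u0 `^ r <= 2 `^ r * G u0 * u `^ r.
  elim: n u => [|n IH] u h1 h2.
    by apply: base => //; apply: (le_trans h2); rewrite expr0 ler_pM2r// ler1n.
  have [h3|h3] := lerP u (2 * u0); first exact: base.
  have uE : u = 2 * (u / 2) by field.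
  have h4 : u0 < u / 2 by lra.
  have h5 : u / 2 <= 2 ^+ n * u0 by move: h2; rewrite exprS; lra.
  have h6 := HM _ (lt_trans Mu0 h4); rewrite -uE in h6.
  have h7 := IH _ (ltW h4) h5.
  have -> : u `^ r = 2 `^ r * (u / 2) `^ r.
    by rewrite -powRM// -?uE//; lra.
  apply: (@le_trans _ _ (2 `^ r * (G (u / 2) * u0 `^ r))).
    by rewrite mulrA ler_pM2r.
  by rewrite [leRHS]mulrCA ler_pM2l// powR_gt0.
exists (2 `^ r * G u0 / u0 `^ r); near=> u.
rewrite mulrAC ler_pdivlMr//.
have u0u : u0 <= u by near: u; apply: nbhs_pinfty_ge; rewrite num_real.
pose n := Num.bound (u / u0).
apply: (main n) => //; rewrite -ler_pdivrMr//.
have /ltW /le_trans : u / u0 < n%:R by rewrite archi_boundP// divr_ge0// ltW// (lt_le_trans u00).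
apply; rewrite -natrX ler_nat ltnW//; exact: ltn_expl.
Unshelve. all: by end_near. Qed.

(** The growth bound is applied with an exponent strictly between 1 / beta and r,
    which leaves a positive power of u in the denominator. *)
Lemma inverse_negligible {r : R} (c : R) : beta^-1 < r ->
  G u * (c / u `^ r) @[u --> +oo] --> (0 : R).
Proof.
move=> br; pose r' := (beta^-1 + r) / 2.
have [br' r'r] : beta^-1 < r' /\ r' < r by rewrite /r'; split; lra.
have [K HK] := inverse_growth br'.
pose e := (r - r') / 2; have e0 : 0 < e by rewrite divr_gt0// subr_gt0.
have H0 := nbhs_pinfty_gt (num_real (0 : R)).
apply/cvgrPdist_le => eps eps0.
pose A := `|K| * `|c| / eps.
have A0 : 0 <= A by rewrite divr_ge0 ?mulr_ge0// ltW.
near=> u; have u0 : 0 < u by near: u.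
have ur0 : 0 < u `^ r by rewrite powR_gt0.
have ud0 : 0 < u `^ (r - r') by rewrite powR_gt0.
have Gu0 : 0 <= G u by rewrite fine_ge0// gen_inverse_ge0.
have GK : G u <= `|K| * u `^ r'.
  have : G u <= K * u `^ r' by near: u.
  move=> /le_trans; apply; rewrite ler_wpM2r ?powR_ge0//; exact: ler_norm.
have Au : A <= u `^ (r - r').
  have Aq : A `^ (r - r')^-1 <= u.
    by near: u; apply: nbhs_pinfty_ge; rewrite num_real.
  have rr : 0 < r - r' by rewrite subr_gt0.
  have : (A `^ (r - r')^-1) `^ (r - r') <= u `^ (r - r').
    by apply: ge0_ler_powR; rewrite ?nnegrE ?powR_ge0// ltW.
  by rewrite -powRrM mulVf ?gt_eqF// powRr1.
have urE : u `^ r = u `^ r' * u `^ (r - r').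
  by rewrite -powRD ?subrKC//; rewrite (gt_eqF u0) implybT.
rewrite sub0r normrN normrM (ger0_norm Gu0) normrM normfV (gtr0_norm ur0).
rewrite mulrA ler_pdivrMr//.
apply: (@le_trans _ _ (`|K| * u `^ r' * `|c|)); first by rewrite ler_wpM2r.
rewrite urE mulrAC mulrC [leRHS]mulrCA ler_wpM2l ?powR_ge0//.
by rewrite [leRHS]mulrC -ler_pdivrMr.
Unshelve. all: by end_near. Qed.

(** The limit of G F is inherited by any function squeezed between dilates of F,
    up to an error of order u^-r that G cannot compensate. *)
Lemma cvg_inverse_mul_perturbed (F psi : R -> R) (m r : R) : 0 <= m ->
  (forall u, 0 <= F u) ->
  (forall s t, 0 < s -> s <= t -> F t <= F s) ->
  v * F (b v) @[v --> +oo] --> m ->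
  beta^-1 < r ->
  (forall s : R, 1 < s -> exists K : R, \forall u \near +oo,
     psi u <= F (s^-1 * u) + K / u `^ r /\ F (s * u) <= psi u + K / u `^ r) ->
  G u * psi u @[u --> +oo] --> m.
Proof.
move=> m0 F0 F_ni Fm br H; have GF := cvg_inverse_mul m0 F_ni Fm.
have idy : (u : R) @[u --> +oo] --> +oo by exact: cvg_id.
have scaled (y : R) : 0 < y -> G (y * u) * F (y * u) @[u --> +oo] --> m.
  by move=> y0; apply: (cvg_comp _ _ _ GF); exact: gt0_cvgMry.
have Gge0 u : 0 <= G u by rewrite fine_ge0// gen_inverse_ge0.
have pick_s (x : R) : 1 < x -> exists2 s : R, 1 < s & s `^ beta^-1 < x.
  move=> x1; exists (((1 + x) / 2) `^ beta).
    by apply: powR_gt1 => //; lra.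
  by rewrite -powRrM mulfV ?gt_eqF// powRr1; lra.
apply: cvg_of_factor_bounds => // x x1;
  have x0 : 0 < x := lt_trans ltr01 x1;
  have [s s1 sx] := pick_s x x1; have s0 : 0 < s := lt_trans ltr01 s1;
  have [K HK] := H s s1; have HG := inverse_scale_le (ltW s1) sx;
  have N := inverse_negligible K br.
- exists (fun u => G (s^-1 * u) * F (s^-1 * u) + x^-1 * (G u * (K / u `^ r))).
    rewrite -[X in _ --> X]addr0; apply: cvgD; first by apply: scaled; rewrite invr_gt0.
    by rewrite -[X in _ --> X](mulr0 x^-1); apply: cvgMr.
  have si0 : 0 < s^-1 by rewrite invr_gt0.
  have siy : s^-1 * u @[u --> +oo] --> +oo by exact: gt0_cvgMry.
  have HG' := siy _ HG.
  near=> u.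
  have [psiF _] : psi u <= F (s^-1 * u) + K / u `^ r /\ F (s * u) <= psi u + K / u `^ r.
    by near: u.
  have Gs : G u <= x * G (s^-1 * u).
    rewrite -{1}(mulVKf (lt0r_neq0 s0) u).
    by near: u.
  rewrite mulrDr (mulrA x x^-1) divff ?gt_eqF// mul1r.
  apply: (@le_trans _ _ (G u * (F (s^-1 * u) + K / u `^ r))); first by rewrite ler_wpM2l.
  by rewrite mulrDr lerD2r mulrA ler_wpM2r.
- exists (fun u => G (s * u) * F (s * u) - x * (G u * (K / u `^ r))).
    rewrite -[X in _ --> X]subr0; apply: cvgB; first exact: scaled.
    by rewrite -[X in _ --> X](mulr0 x); apply: cvgMr.
  near=> u.
  have [_ Fpsi] : psi u <= F (s^-1 * u) + K / u `^ r /\ F (s * u) <= psi u + K / u `^ r.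
    by near: u.
  have Gs : G (s * u) <= x * G u by near: u.
  rewrite lerBlDr -mulrDr -mulrDr.
  apply: (@le_trans _ _ (x * G u * F (s * u))); first by rewrite ler_wpM2r.
  by rewrite -mulrA ler_wpM2l ?(ltW x0)// ler_wpM2l.
Unshelve. all: by end_near. Qed.

End GeneralizedInverse.

(** * Row vectors, cones and dilations *)

Lemma coord_le_norm {R : realType} {d : nat} (z : 'rV[R]_d) (j : 'I_d) :
  z ord0 j <= `|z|.
Proof.
rewrite (le_trans (ler_norm _))// /Num.Def.normr/= mx_normrE.
exact: (le_bigmax _ (fun ij : 'I_1 * 'I_d => `|z ij.1 ij.2|) (ord0, j)).
Qed.

Section RowVectors.
Context {R : realType} {d : nat}.
Implicit Types (z : 'rV[R]_d) (B C : set 'rV[R]_d).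

Lemma continuous_borel_measurable (g : 'rV[R]_d -> 'rV[R]_d) :
  continuous g -> measurable_fun setT (g : borel_rV R d -> borel_rV R d).
Proof.
move=> cg.
apply: (@measurability _ _ (borel_rV R d) (borel_rV R d) setT g open) => //.
move=> _ [U oU <-]; rewrite setTI; apply: sub_sigma_algebra.
by apply: open_comp => // z _; exact: cg.
Qed.

Lemma coord_measurable (j : 'I_d) :
  measurable_fun setT (fun z : borel_rV R d => (z : 'rV[R]_d) ord0 j : R).
Proof.
apply: (measurability _ (RGenOpens.measurableE R)).
move=> _ [_ [s [t ->]] <-]; rewrite setTI; apply: sub_sigma_algebra.
apply: (@open_comp 'rV[R]_d R (fun z => z ord0 j)) => [z _|].
  exact: coord_continuous.
exact: interval_open.
Qed.

Lemma measurable_coords_ge0 {dO : measure_display} {Omega : measurableType dO}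
    (g : 'I_d -> Omega -> R) :
  (forall j, measurable_fun setT (g j)) ->
  measurable [set w | forall j, 0 <= g j w].
Proof.
move=> mg.
have -> : [set w | forall j, 0 <= g j w] =
    \bigcap_(j in [set: 'I_d]) (g j @^-1` `[0, +oo[).
  apply/seteqP; split => w /= H j; first by move=> _; rewrite /= in_itv/= andbT.
  by have := H j I; rewrite /= in_itv/= andbT.
apply: fin_bigcap_measurable => // j _.
by rewrite -[X in measurable X]setTI; exact: mg.
Qed.

Lemma orthant_measurable : measurable (orthant : set (borel_rV R d)).
Proof.
exact: (measurable_coords_ge0 _ coord_measurable).
Qed.

Lemma cone_scale C (r : R) z : is_cone C -> 0 < r -> C z -> C (r *: z).
Proof. by move=> cC r0 Cz; rewrite -(cC r r0); exists z. Qed.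

Lemma increasing_le C z z' : increasing_set C -> C z ->
  (forall j, z ord0 j <= z' ord0 j) -> C z'.
Proof.
move=> iC Cz zz'; rewrite -(subrK z z'); apply: iC => // j.
by rewrite !mxE subr_ge0.
Qed.

(** For a cone C, dilating the region by r only moves its apex from a to r a.
    This is why perturbations of the apex translate into changes of r. *)
Lemma dilate_region C (a : 'rV[R]_d) (r : R) z : is_cone C -> 0 < r ->
  dilate r (translate a C `&` orthant) z <-> C (z - r *: a) /\ orthant z.
Proof.
move=> cC r0; split.
  move=> [_ [[c Cc <-] o] <-]; split; last first.
    by move=> j; rewrite mxE mulr_ge0// ltW.
  by rewrite scalerDr addrC addKr; apply: cone_scale.
move=> [Cz oz]; exists (r^-1 *: z); last by rewrite scalerA mulfV ?gt_eqF// scale1r.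
split; last by move=> j; rewrite mxE mulr_ge0// invr_ge0 ltW.
exists (r^-1 *: (z - r *: a)); first by apply: cone_scale; rewrite ?invr_gt0.
by rewrite scalerBr scalerA mulVf ?gt_eqF// scale1r addrC subrK.
Qed.

Lemma dilate_measurable B (r : R) : 0 < r ->
  measurable (B : set (borel_rV R d)) ->
  measurable (dilate r B : set (borel_rV R d)).
Proof.
move=> r0 mB.
have -> : dilate r B = setT `&` (fun z => r^-1 *: z) @^-1` B.
  rewrite setTI; apply/seteqP; split => [_ [z Bz <-]|z Bz] /=.
    by rewrite scalerA mulVf ?gt_eqF// scale1r.
  by exists (r^-1 *: z) => //; rewrite scalerA mulfV ?gt_eqF// scale1r.
apply: (continuous_borel_measurable (fun z => r^-1 *: z)) => //.
exact: scaler_continuous.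
Qed.

End RowVectors.

(** * Monotonicity of the paths of a nonnegative Levy process *)

Section LevyMonotone.
Context {R : realType} {dO : measure_display} {Omega : measurableType dO}.
Context {P : probability Omega R} {d : nat}.
Variable X : R -> Omega -> 'rV[R]_d.
Hypothesis levyX : levy_process P X.
Hypothesis X_ge0 : forall t w, 0 <= t -> orthant (X t w).

(** The increment has the law of X (T - t), which takes its values in the
    orthant. *)
Lemma increment_ge0_ae (t T : R) : 0 <= t -> t <= T ->
  {ae P, forall w, orthant (X T w - X t w)}.
Proof.
move=> t0 tT; case: levyX => mX _ statX _ _.
have mE : measurable [set w | orthant (X T w - X t w)].
  rewrite (_ : [set _ | _] = [set w | forall j, 0 <= X T w ord0 j - X t w ord0 j]).
    apply: measurable_coords_ge0 => j; apply: measurable_funB.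
    - by apply: measurableT_comp (coord_measurable j) (mX T _); exact: le_trans tT.
    - exact: measurableT_comp (coord_measurable j) (mX t t0).
  by apply/seteqP; split=> w /= H j; have := H j; rewrite !mxE.
have P1 : P [set w | orthant (X T w - X t w)] = 1%E.
  have := statX t (T - t) orthant t0; rewrite subr_ge0 subrKC.
  move=> /(_ tT orthant_measurable) ->.
  rewrite (_ : [set _ | _] = setT) ?probability_setT//.
  by apply/seteqP; split=> // w _ /=; apply: X_ge0; rewrite subr_ge0.
exists (~` [set w | orthant (X T w - X t w)]); split => //.
- exact: measurableC.
- by rewrite probability_setC// P1 subee.
Qed.

(** A single null set is needed for all t: it is obtained from the rational times,
    and right-continuity transfers the comparison to the others. *)
Lemma paths_below_end_ae (T : R) :
  {ae P, forall w, forall t, 0 <= t <= T -> orthant (X T w - X t w)}.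
Proof.
(* The rationals are indexed by their codes, as almost sure statements are
   closed under intersections indexed by nat. *)
have rat_ae : {ae P, forall w, forall n q, unpickle n = Some (q : rat) ->
    0 <= (ratr q : R) <= T -> orthant (X T w - X (ratr q) w)}.
  apply: (@ae_foralln _ _ _ P (fun n w => forall q, unpickle n = Some (q : rat) ->
    0 <= (ratr q : R) <= T -> orthant (X T w - X (ratr q) w))) => n; case: (unpickle n) => [q|]; last by apply: aeW.
  have [/andP[q0 qT]|qN] := boolP (0 <= (ratr q : R) <= T).
    have := increment_ge0_ae _ _ q0 qT; apply: filterS => w H q' [<-] //.
  by apply: aeW => w q' [<-]; rewrite (negbTE qN).
apply: filterS rat_ae => w H t /andP[t0]; rewrite le_eqVlt => /predU1P[->|tT].
  by rewrite subrr => j; rewrite mxE.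
move=> j; rewrite !mxE subr_ge0 leNgt; apply/negP => lt_end.
case: levyX => _ _ _ _ /(_ w) [/(_ t t0) rc _].
have rcj : X s w ord0 j @[s --> t^'+] --> X t w ord0 j.
  by apply: cvg_trans (@coord_continuous R 1 d ord0 j (X t w)); exact: (cvg_app (fun z : 'rV[R]_d => z ord0 j) rc).
have [e /= e0 He] := cvgr_gt _ rcj _ lt_end.
have tm : t < Num.min T (t + e) by rewrite lt_min tT ltrDl.
have [q] := rat_in_itvoo tm; rewrite in_itv/= lt_min => /and3P[tq qT qe].
have : X T w ord0 j < X (ratr q) w ord0 j.
  by apply: He => //=; rewrite ltr0_norm ?subr_lt0// opprB ltrBlDl.
have q0T : 0 <= (ratr q : R) <= T by rewrite (le_trans t0 (ltW tq)) ltW.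
have := H (pickle q) q (pickleK q) q0T j.
by rewrite !mxE subr_ge0 leNgt => /negP.
Qed.

End LevyMonotone.

(** * Probability estimates *)

Lemma measure_le_fine_add {R : realType} {dO : measure_display}
    {Omega : measurableType dO} (P : probability Omega R) (A E F : set Omega) :
  measurable A -> measurable E -> measurable F ->
  {ae P, forall w, A w -> (E `|` F) w} ->
  fine (P A) <= fine (P E) + fine (P F).
Proof.
move=> mA mE mF [N [mN N0 AN]].
have AE : A `<=` (E `|` F) `|` N.
  move=> w Aw; have [EFw|nEF] := pselect ((E `|` F) w); first by left.
  by right; apply: AN => /= /(_ Aw).
rewrite -lee_fin EFinD !fineK ?fin_num_measure//.
apply: (@le_trans _ _ (P ((E `|` F) `|` N))).
  by apply: le_measure => //; rewrite inE//; do !apply: measurableU.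
have mEF : measurable (E `|` F) by exact: measurableU.
have -> : P ((E `|` F) `|` N) = P (E `|` F) by apply: measureU0.
exact: measureU2.
Qed.

Lemma measurable_abs_tail {R : realType} {dO : measure_display}
    {Omega : measurableType dO} (S : Omega -> \bar R) (t : R) :
  measurable_fun setT S -> measurable [set w | (t%:E <= `|S w|)%E].
Proof.
move=> mS; rewrite -[X in measurable X]setTI.
by apply: emeasurable_fun_c_infty => //; exact: measurableT_comp.
Qed.

(** Markov inequality for the power r, with the threshold split as e * u so that
    the dependence on u is a plain power. *)
Lemma moment_tail_bound {R : realType} {dO : measure_display}
    {Omega : measurableType dO} (P : probability Omega R)
    (S : Omega -> \bar R) (r e u : R) :
  measurable_fun setT S -> (\int[P]_w (`|S w| `^ r) < +oo)%E ->
  0 <= r -> 0 < e -> 0 < u ->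
  fine (P [set w | ((e * u)%:E <= `|S w|)%E]) <=
    fine (\int[P]_w (`|S w| `^ r)) / e `^ r / u `^ r.
Proof.
move=> mS Sfin r0 e0 u0; have eu0 : 0 < e * u by rewrite mulr_gt0.
have mE := measurable_abs_tail S (e * u) mS.
have I0 : (0 <= \int[P]_w (`|S w| `^ r))%E.
  by apply: integral_ge0 => w _; exact: poweR_ge0.
rewrite -mulrA -invfM -(powRM _ (ltW e0) (ltW u0)).
rewrite ler_pdivlMr ?powR_gt0// mulrC.
rewrite -lee_fin EFinM !fineK ?fin_num_measure// ?ge0_fin_numE//.
rewrite -poweR_EFin -[X in P X]setTI.
apply: (@le_integral_comp_abse _ _ _ P setT measurableT S (e * u)
  (fun y => (y `^ r)%E)) => //.
- exact: measurable_poweR.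
- by move=> y _; exact: poweR_ge0.
- move=> y z; rewrite !inE/= !in_itv/= !andbT => y0 z0 yz.
  by apply: gt0_ler_poweR => //; rewrite in_itv/= ?y0 ?z0 leey.
Qed.

(** * Pathwise comparison of ruin with the claims at the final time *)

Section RuinSandwich.
Context {R : realType} {d : nat}.
Variables (C : set 'rV[R]_d) (a p x : 'rV[R]_d).
Hypotheses (C_cone : is_cone C) (C_incr : increasing_set C).
Let Lambda : set 'rV[R]_d := [set - z | z in translate x C].
Let B : set 'rV[R]_d := translate a C `&` orthant.

Lemma risk_set_mem z : Lambda z <-> C (- z - x).
Proof.
split=> [[_ [c Cc <-] <-]|Cz]; first by rewrite opprK addrC addKr.
exists (- z); last by rewrite opprK.
by exists (- z - x) => //; rewrite addrC subrK.
Qed.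

Lemma dilate_region_anti (r s : R) : orthant a -> 0 < r -> r <= s ->
  dilate s B `<=` dilate r B.
Proof.
move=> oa r0 rs z; have s0 := lt_le_trans r0 rs.
move=> /(dilate_region _ _ _ _ C_cone s0)[Cz oz].
apply/(dilate_region _ _ _ _ C_cone r0); split=> //.
apply: (increasing_le _ _ _ C_incr Cz) => j; rewrite !mxE lerD2l lerN2.
by rewrite ler_wpM2r.
Qed.

Context {dO : measure_display} {Omega : measurableType dO}.
Variables (L Q : R -> Omega -> 'rV[R]_d) (T : R) (w : Omega).

Lemma coord_le_running_sup (m t : R) j : (running_sup Q T w < m%:E)%E ->
  0 <= t <= T -> `|Q t w ord0 j| <= m.
Proof.
move=> Qm tT; have Qt : `|Q t w| <= m.
  rewrite -lee_fin; apply: le_trans (ltW Qm); apply: ereal_sup_ubound.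
  by exists t => //=; rewrite in_itv.
rewrite ler_norml; apply/andP; split; last exact: le_trans (coord_le_norm _ _) Qt.
rewrite lerNl; apply: le_trans Qt; rewrite -normrN.
by apply: le_trans (coord_le_norm _ j); rewrite mxE.
Qed.

(** Replacing L t by L T and dropping t p, x and Q t can lower a coordinate by at
    most m, which the larger distance between the apices u a and (u / s) a
    makes up for. *)
Lemma ruin_sub_end (u s m : R) : orthant p -> orthant x -> 0 < u -> 1 < s ->
  orthant (L T w) ->
  (forall t, 0 <= t <= T -> orthant (L T w - L t w)) ->
  (running_sup Q T w < m%:E)%E ->
  (forall j, m <= (1 - s^-1) * u * a ord0 j) ->
  hitting_event (risk_process a p L Q u) Lambda T w ->
  dilate (s^-1 * u) B (L T w).
Proof.
move=> op ox u0 s1 oL mono Qm ma [t tT].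
rewrite risk_set_mem => Cr.
have su0 : 0 < s^-1 * u by rewrite mulr_gt0// invr_gt0 (lt_trans ltr01).
apply/(dilate_region _ _ _ _ C_cone su0); split => //.
apply: (increasing_le _ _ _ C_incr Cr) => j.
have := mono t tT j; have := ma j.
have := coord_le_running_sup m t j Qm tT; rewrite ler_norml => /andP[].
have := ox j; have := op j; have : 0 <= t by case/andP: tT.
rewrite !mxE; move=> t0 pj xj; have : 0 <= t * p ord0 j by rewrite mulr_ge0.
lra.
Qed.

(** Ruin is witnessed at time T: the excess (s - 1) u a of the claims over the
    reserve pays for the premiums, the shift x and the perturbation. *)
Lemma end_sub_ruin (u s m : R) : 0 <= T -> 0 < u -> 0 < s ->
  (running_sup Q T w < m%:E)%E ->
  (forall j, m + T * p ord0 j + x ord0 j <= (s - 1) * u * a ord0 j) ->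
  dilate (s * u) B (L T w) ->
  hitting_event (risk_process a p L Q u) Lambda T w.
Proof.
move=> T0 u0 s0 Qm ma; have su0 : 0 < s * u by rewrite mulr_gt0.
move=> /(dilate_region _ _ _ _ C_cone su0)[Cz _].
have TT : 0 <= T <= T by rewrite T0 lexx.
exists T => //; rewrite risk_set_mem.
apply: (increasing_le _ _ _ C_incr Cz) => j.
have := ma j; have := coord_le_running_sup m T j Qm TT.
rewrite ler_norml => /andP[]; rewrite !mxE; lra.
Qed.

End RuinSandwich.

Lemma positive_coords_lbound {R : realType} {d : nat} (a : 'rV[R]_d) :
  (forall j, 0 < a ord0 j) -> exists2 k : R, 0 < k & forall j, k <= a ord0 j.
Proof.
move=> a0; exists (\big[Num.min/1]_j a ord0 j); last by move=> j; exact: bigmin_le_cond.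
by apply: lt_bigmin.
Qed.

(** * Asymptotics of the ruin probability *)

Theorem theorem3p1 (R : realType) (dO : measure_display)
    (Omega : measurableType dO) (P : probability Omega R)
    (d : nat) (hd : (2 <= d)%N) (i : nat) (hi : (1 <= i <= d)%N)
    (T : R) (hT : 0 < T)
    (L : R -> Omega -> 'rV[R]_d)
    (alpha : nat -> R) (b : nat -> R -> R)
    (mu : nat -> {measure set (borel_rV R d) -> \bar R})
    (f : nat -> R -> {posnum R})
    (hL : insurance_claim P L alpha b mu f)
    (hb : forall s t : R, 0 <= s -> s <= t -> b i s <= b i t)
    (Q : R -> Omega -> 'rV[R]_d) (hQ : process Q)
    (hLQ : independent_processes P L Q)
    (hQsup : measurable_fun setT (running_sup Q T))
    (gamma : R) (hgamma : 0 < gamma)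
    (hQmoment :
      (\int[P]_w (`|running_sup Q T w| `^ (alpha i + gamma)) < +oo)%E)
    (a : 'rV[R]_d) (ha : forall j, 0 < a ord0 j)
    (ha1 : \sum_(j < d) a ord0 j = 1)
    (p : 'rV[R]_d) (hp : orthant p)
    (x : 'rV[R]_d) (hx : orthant x)
    (C : set 'rV[R]_d) (hCborel : measurable (C : set (borel_rV R d)))
    (hCincr : increasing_set C) (hCcone : is_cone C) :
  let Lambda : set 'rV[R]_d := [set - z | z in translate x C] in
  let ruin (u : R) : set Omega :=
    hitting_event (risk_process a p L Q u) Lambda T in
  let psi (u : R) : \bar R := P (ruin u) in
  let B : set 'rV[R]_d := translate a C `&` orthant in
  (forall u : R, 0 < u -> measurable (ruin u)) ->
  borel_in (subcone i) B ->
  bounded_away B (coord_cone i) ->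
  continuity_set (mu i) (subcone i) B ->
  ((gen_inverse (b i) u * psi u)%E @[u --> +oo]
     --> ((f i T)%:num%:E * mu i B)%E) /\
  ((0 < mu i B < +oo)%E ->
     fine (psi u) / fine (P (L T @^-1` dilate u B)) @[u --> +oo]
       --> (1 : R)).
Proof.
move=> Lambda ruin psi B mruin Bsub Baway Bcont.
case: hL => levyL L0 /(_ i hi) [alpha0 brv _ _ /(_ T hT)].
move=> [_ _ [_ mufin] _ /(_ B Bsub Baway)].
have cont : continuity_set (mscale (f i T)%:num%:nng (mu i)) (subcone i) B.
  by rewrite /continuity_set/= /mscale/= [X in (_ * X)%E]Bcont mule0.
move=> /(_ cont) lim {cont}.
have beta0 : 0 < (alpha i)^-1 by rewrite invr_gt0.
have mB : measurable (B : set (borel_rV R d)) := Bsub.1.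
have mLB u : 0 < u -> measurable (L T @^-1` dilate u B).
  move=> u0; rewrite -[X in measurable X]setTI.
  by case: levyL => /(_ T (ltW hT)) mL _ _ _ _; apply: mL => //; exact: dilate_measurable.
pose F (u : R) : R := fine (P (L T @^-1` dilate u B)).
pose G (u : R) : R := fine (gen_inverse (b i) u).
pose m : R := fine ((f i T)%:num%:E * mu i B)%E.
have mE : ((f i T)%:num%:E * mu i B)%E = m%:E.
  have h0 : (0 <= (f i T)%:num%:E * mu i B)%E by rewrite mule_ge0.
  rewrite fineK// ge0_fin_numE//; exact: mufin.
have m0 : 0 <= m by rewrite -lee_fin -mE mule_ge0.
have F0 u : 0 <= F u by rewrite fine_ge0.
have oa : orthant a by move=> j; exact: ltW.
have F_ni s t : 0 < s -> s <= t -> F t <= F s.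
  move=> s0 st; have t0 := lt_le_trans s0 st.
  apply: fine_le.
  - exact: fin_num_measure (mLB t t0).
  - exact: fin_num_measure (mLB s s0).
  apply: le_measure; rewrite ?inE; [exact: mLB..|].
  by move=> w; exact: dilate_region_anti.
have H0 := nbhs_pinfty_gt (num_real (0 : R)).
have b0 := rv_gt0 _ _ brv.
have Fm : v * F (b i v) @[v --> +oo] --> m.
  have : fine (v%:E * P (L T @^-1` dilate (b i v) B)) @[v --> +oo] --> m.
    by apply: fine_cvg; rewrite -mE; exact: lim.
  apply: cvg_trans; apply: near_eq_cvg; near=> v.
  have bv0 : 0 < b i v by near: v.
  by rewrite fineM// fin_num_measure//; exact: mLB.
have [k k0 ka] := positive_coords_lbound a ha.
have Gpsi : G u * fine (psi u) @[u --> +oo] --> m.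
  apply: (cvg_inverse_mul_perturbed _ _ hb brv beta0 F (fine \o psi) m
    (alpha i + gamma)) => //; first by rewrite invrK ltrDl.
  move=> s s1; have s0 : 0 < s := lt_trans ltr01 s1.
  have is1 : s^-1 < 1 by rewrite invf_lt1.
  (* Half of the room (1 - 1/s) k left by each dilation: the lower bound needs
     the other half to absorb T p and x. *)
  pose e := (1 - s^-1) * k / 2.
  have e0 : 0 < e by rewrite /e divr_gt0// mulr_gt0// subr_gt0.
  exists (fine (\int[P]_w (`|running_sup Q T w| `^ (alpha i + gamma)))
     / e `^ (alpha i + gamma)).
  pose c := T * `|p| + `|x|.
  have Hc := nbhs_pinfty_ge (num_real (c / e)).
  near=> u; have u0 : 0 < u by near: u.
  pose E := [set w | ((e * u)%:E <= `|running_sup Q T w|)%E].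
  have mE' : measurable E by exact: measurable_abs_tail.
  have tail : fine (P E) <= fine (\int[P]_w (`|running_sup Q T w| `^ (alpha i + gamma)))
     / e `^ (alpha i + gamma) / u `^ (alpha i + gamma).
    by apply: moment_tail_bound => //; rewrite addr_ge0 ?ltW.
  have notE w : ~ E w -> (running_sup Q T w < (e * u)%:E)%E.
    move=> /negP; rewrite -ltNge; apply: le_lt_trans; exact: lee_abs.
  have su0 : 0 < s * u by rewrite mulr_gt0.
  have isu0 : 0 < s^-1 * u by rewrite mulr_gt0// invr_gt0.
  split.
  - apply: le_trans (lerD (lexx _) tail).
    apply: measure_le_fine_add => //; [exact: mruin|exact: mLB|].
    apply: filterS (paths_below_end_ae _ levyL L0 T) => w mono hit.
    have [Ew|/notE Qw] := pselect (E w); [by right|left].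
    apply: (ruin_sub_end _ _ p x _ _ L Q T w u s (e * u)) => //.
      by apply: L0; exact: ltW.
    move=> j; rewrite [leRHS]mulrAC ler_pM2r// /e -mulrA ler_pM2l ?subr_gt0//.
    by apply: le_trans (ka j); rewrite ler_pdivrMr// ler_peMr ?ler1n// ltW.
  - apply: le_trans (lerD (lexx _) tail).
    apply: measure_le_fine_add => //; [exact: mLB|exact: mruin|].
    apply: aeW => w hit.
    have [Ew|/notE Qw] := pselect (E w); [by right|left].
    apply: (end_sub_ruin _ _ _ _ _ _ L Q T w u s (e * u)) => //; first exact: ltW.
    move=> j.
    have cj : T * p ord0 j + x ord0 j <= c.
      by apply: lerD; rewrite ?coord_le_norm// ler_pM2l// coord_le_norm.
    have cu : c <= e * u.
      by rewrite [leRHS]mulrC -ler_pdivrMr//; near: u.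
    (* 1 - 1/s <= s - 1, so that e serves for both bounds. *)
    have es : e * 2 <= (s - 1) * k.
      rewrite /e divfK// ler_pM2r//.
      have : (s - 1) * (1 - s^-1) >= 0 by rewrite mulr_ge0// subr_ge0 ltW.
      by rewrite mulrBr mulr1 mulrBl mulfV ?gt_eqF// mul1r; lra.
    have h1 : e * 2 * u <= (s - 1) * k * u by rewrite ler_pM2r.
    have h2 : (s - 1) * k * u <= (s - 1) * u * a ord0 j.
      by rewrite mulrAC ler_pM2l// mulr_gt0// subr_gt0.
    lra.
split.
  rewrite mE.
  have : (G u * fine (psi u))%:E @[u --> +oo] --> m%:E.
    by apply: cvg_EFin; [exact: nearW|exact: Gpsi].
  apply: cvg_trans; apply: near_eq_cvg; near=> u.
  have u0 : 0 < u by near: u.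
  rewrite EFinM !fineK//; first exact: fin_num_measure (mruin u u0).
  exact: (gen_inverse_fin _ _ brv beta0).
move=> /andP[muB0 muBfin].
have mpos : 0 < m by rewrite -lte_fin -mE mule_gt0.
have GF := cvg_inverse_mul _ _ hb brv beta0 m0 F_ni Fm.
have : (G u * fine (psi u)) / (G u * F u) @[u --> +oo] --> m / m.
  by apply: cvgM => //; apply: cvgV => //; rewrite gt_eqF.
rewrite divff ?gt_eqF//.
apply: cvg_trans; apply: near_eq_cvg.
have Gpos := inverse_near_gt0 _ _ hb brv beta0.
near=> u; have Gu : 0 < G u by near: u.
by rewrite invfM mulrACA divff ?mul1r// gt_eqF.
Unshelve. all: by end_near. Qed.
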